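(* Let $n$ be an odd prime, let $q\in\mathbb{C}$ be a primitive $n$-th root of unity, and let $B=\begin{pmatrix} a & b\\ c& d\end{pmatrix}\in SL_2(\mathbb{Z})$. Then the conjugating matrix associated with $B$ (which is defined only up to a nonzero scalar multiple) is $$C=(c_{i,j})_{i,j=0}^{n-1}=\left(q^{-b^{-1}d(i-aj)^2-2cj(i-aj)-acj^2}\right)_{i,j=0}^{n-1},$$ where $b^{-1}$ is the multiplicative inverse of $b$ in $\mathbb{Z}/n\mathbb{Z}$.
   Context: For $q\in\mathbb{C}\setminus\{0\}$, $\mathcal{W}_q=\mathbb{C}[l,l^{-1},m,m^{-1}]_q$ is the associative unital $\mathbb{C}$-algebra of noncommuting Laurent polynomials in $l,m$ with $lm=q^2ml$. It has $\mathbb{C}$-basis $e_{r,s}=q^{-rs}l^rm^s$ ($r,s\in\mathbb{Z}$). The group $SL_2(\mathbb{Z})$ acts on $\mathcal{W}_q$ by algebra automorphisms, given on basis elements by $\begin{pmatrix} a & b\\ c& d\end{pmatrix}\cdot e_{p,t}=e_{ap+bt,\,cp+dt}$ and extended linearly. Rows and columns of $n\times n$ matrices are indexed by $0,\dots,n-1$. $L$ is the cyclic permutation matrix with $L_{i,j}=1$ if $i\equiv j+1 \pmod n$ and $0$ otherwise; $M$ is the diagonal matrix with entries $M_{i,i}=q^{-2i}$. There is a surjective algebra homomorphism $\rho:\mathcal{W}_q\to M_n(\mathbb{C})$ with $\rho(l)=L$, $\rho(m)=M$; its kernel is preserved by the action of $SL_2(\mathbb{Z})$, so each $B\in SL_2(\mathbb{Z})$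 induces an automorphism $\theta_B$ of $M_n(\mathbb{C})$ with $\theta_B(\rho(x))=\rho(B\cdot x)$ for all $x\in\mathcal{W}_q$. By the Skolem-Noether theorem this automorphism is inner; the conjugating matrix associated with $B$ is an invertible matrix $C$, unique up to nonzero scalar multiples, with $\theta_B(X)=CXC^{-1}$ for all $X\in M_n(\mathbb{C})$. Exponents of $q$ are read modulo $n$.
   Formalization: The theorem is stated for B whose entry b is not divisible by n; when n divides b (for example B the identity), the inverse of b in Z/nZ does not exist and the formula for C is undefined. *)

(* Defs.v *)
From HB Require Import structures.
From mathcomp Require Import all_boot all_order all_algebra fingroup perm.
From mathcomp Require Import reals complex finmap.
From mathcomp.multinomials Require Import monalg.
From mathcomp Require Import ring.

Set Implicit Arguments.
Unset Strict Implicit.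
Unset Printing Implicit Defensive.

Import GRing.Theory Num.Theory.
Local Open Scope ring_scope.

(* [lext f] is the linear extension of [f], defined on the basis [K], to the
   free module {malg F[K]} of finitely supported functions K -> F. *)
HB.lock Definition lext (F : fieldType) (K : choiceType) (V : lmodType F)
    (f : K -> V) (x : {malg F[K]}) : V :=
  \sum_(k <- msupp x) x@_k *: f k.

Section LinearExtension.
Context (F : fieldType) (K : choiceType) (V : lmodType F).
Implicit Types (f : K -> V) (x y : {malg F[K]}) (D : {fset K}).

Lemma lextw f D x : (msupp x `<=` D)%fset ->
  lext f x = \sum_(k <- D) x@_k *: f k.
Proof.
move=> le; rewrite lext.unlock (big_fset_incl _ le) //= => k _ /mcoeff_outdom ->.
by rewrite scale0r.
Qed.

Lemma lextD f x y : lext f (x + y) = lext f x + lext f y.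
Proof.
rewrite (lextw f (msuppD_le x y)) (lextw f (fsubsetUl _ (msupp y))).
rewrite (lextw f (fsubsetUr (msupp x) _)) -big_split /=.
by apply/eq_bigr => k _; rewrite mcoeffD scalerDl.
Qed.

Lemma lextZ f c x : lext f (c *: x) = c *: lext f x.
Proof.
rewrite (lextw f (msuppZ_le c x)) lext.unlock scaler_sumr.
by apply/eq_bigr => k _; rewrite mcoeffZ scalerA.
Qed.

Lemma lext_linear f : linear (lext f).
Proof. by move=> c x y; rewrite lextD lextZ. Qed.

HB.instance Definition _ f :=
  GRing.isLinear.Build F {malg F[K]} V *:%R (lext f) (lext_linear f).

Lemma lextU f c k : lext f << c *g k >> = c *: f k.
Proof. by rewrite (lextw f msuppU_le) big_seq_fset1 mcoeffUU. Qed.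

Lemma malg_ind (P : {malg F[K]} -> Prop) :
    P 0 -> (forall x y, P x -> P y -> P (x + y)) ->
    (forall c k, P << c *g k >>) ->
  forall x, P x.
Proof. by move=> P0 PD PU x; rewrite (monalgE x); elim/big_ind: _ => // k _. Qed.

Lemma malgU_scale c (k : K) : << c *g k >> = c *: (<< k >> : {malg F[K]}).
Proof. by apply/malgP => k'; rewrite mcoeffZ !mcoeffU mulrnAr mulr1. Qed.

Lemma malgZU c d (k : K) : c *: (<< d *g k >> : {malg F[K]}) = << c * d *g k >>.
Proof. by apply/malgP => k'; rewrite mcoeffZ !mcoeffU mulrnAr. Qed.

End LinearExtension.

Lemma alg_mul_scale (F : fieldType) (A A' : algType F) (f : A -> A')
    (fZ : forall c x, f (c *: x) = c *: f x) (c d : F) (u v : A) :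
  f (u * v) = f u * f v -> f ((c *: u) * (d *: v)) = f (c *: u) * f (d *: v).
Proof. by move=> fM; rewrite -scalerAl -scalerAr !fZ fM -scalerAl -scalerAr. Qed.

(* The basis element [<< (r, s) >>] is the normally ordered Laurent monomial
   l^r m^s.  The relation l m = q^2 m l forces
     (l^r m^s) (l^u m^v) = q^(-2su) l^(r+u) m^(s+v).
   Associativity needs q != 0, which is why the type records [q0]. *)
Definition qtorus (F : fieldType) (q : F) (q0 : q != 0) := {malg F[(int * int)%type]}.

Section QuantumTorus.
Context (F : fieldType) (q : F) (q0 : q != 0).
Local Notation W := (qtorus q0).

HB.instance Definition _ := GRing.Lmodule.on W.

Definition qtorus_mul (x y : W) : W :=
  lext (fun k1 : int * int =>
    lext (fun k2 : int * int =>
      << q ^ (- (2 * k1.2 * k2.1)) *g (k1 + k2)%R >> : W) y) x.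

Definition qtorus_one : W := << (0, 0) >>.

Lemma qtorus_mulUU c1 c2 (k1 k2 : int * int) :
  qtorus_mul << c1 *g k1 >> << c2 *g k2 >> =
  << c1 * c2 * q ^ (- (2 * k1.2 * k2.1)) *g (k1 + k2)%R >>.
Proof. by rewrite /qtorus_mul !lextU -mulrA !(malgU_scale (_ * _)) -!scalerA
  -malgU_scale. Qed.

Lemma qtorus_mulDl : left_distributive qtorus_mul +%R.
Proof. by move=> x y z; rewrite /qtorus_mul raddfD. Qed.

Lemma qtorus_mulDr : right_distributive qtorus_mul +%R.
Proof.
move=> x y z; elim/malg_ind: x => [|x x' Ex Ex'|c k].
- by rewrite /qtorus_mul !raddf0 addr0.
- by rewrite !qtorus_mulDl Ex Ex' addrACA.
by rewrite /qtorus_mul !lextU raddfD scalerDr.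
Qed.

Lemma qtorus_mul0l y : qtorus_mul 0 y = 0.
Proof. by rewrite /qtorus_mul raddf0. Qed.

Lemma qtorus_mul0r x : qtorus_mul x 0 = 0.
Proof. by apply: (addIr (qtorus_mul x 0)); rewrite -qtorus_mulDr !add0r. Qed.

Lemma qtorus_mulA : associative qtorus_mul.
Proof.
move=> x y z; elim/malg_ind: x => [|x x' Ex Ex'|c k].
- by rewrite !(qtorus_mul0l _).
- by rewrite (qtorus_mulDl x x') Ex Ex' (qtorus_mulDl x x') qtorus_mulDl.
elim/malg_ind: y => [|y y' Ey Ey'|c' k'].
- by rewrite (qtorus_mul0l z) (qtorus_mul0r << _ *g _ >>) qtorus_mul0l.
- rewrite (qtorus_mulDl y y') (qtorus_mulDr << _ *g _ >>) Ey Ey'.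
  by rewrite (qtorus_mulDr << _ *g _ >> y y') qtorus_mulDl.
elim/malg_ind: z => [|z z' Ez Ez'|c'' k''].
- by rewrite !(qtorus_mul0r << _ *g _ >>) qtorus_mul0r.
- rewrite (qtorus_mulDr << _ *g _ >> z z') (qtorus_mulDr << _ *g _ >>) Ez Ez'.
  by rewrite -qtorus_mulDr.
rewrite !qtorus_mulUU addrA; congr mkmalgU => /=.
transitivity (c * c' * c'' *
    q ^ (- (2 * k'.2 * k''.1) + - (2 * k.2 * (k'.1 + k''.1)))).
  by rewrite expfzDr //; ring.
rewrite (_ : _ + _ = - (2 * k.2 * k'.1) + - (2 * (k.2 + k'.2) * k''.1)); last ring.
by rewrite expfzDr //; ring.
Qed.

Lemma qtorus_mul1l : left_id qtorus_one qtorus_mul.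
Proof.
move=> x; elim/malg_ind: x => [|x x' Ex Ex'|c k]; first exact: qtorus_mul0r.
  by rewrite qtorus_mulDr Ex Ex'.
by rewrite qtorus_mulUU mulr0 mul0r oppr0 expr0z mulr1 mul1r add0r.
Qed.

Lemma qtorus_mul1r : right_id qtorus_one qtorus_mul.
Proof.
move=> x; elim/malg_ind: x => [|x x' Ex Ex'|c k]; first exact: qtorus_mul0l.
  by rewrite qtorus_mulDl Ex Ex'.
by rewrite qtorus_mulUU mulr0 oppr0 expr0z !mulr1 addr0.
Qed.

Lemma qtorus_one_neq0 : qtorus_one != 0.
Proof. by rewrite monalgU_eq0 oner_eq0. Qed.

HB.instance Definition _ := GRing.Zmodule_isNzRing.Build W
  qtorus_mulA qtorus_mul1l qtorus_mul1r qtorus_mulDl qtorus_mulDr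
  qtorus_one_neq0.

Lemma qtorus_scaleAl c (x y : W) : c *: (x * y) = (c *: x) * y.
Proof. by rewrite /GRing.mul /= /qtorus_mul lextZ. Qed.

HB.instance Definition _ := GRing.Lmodule_isLalgebra.Build F W qtorus_scaleAl.

Lemma qtorus_scaleAr c (x y : W) : c *: (x * y) = x * (c *: y).
Proof.
elim/malg_ind: x => [|x x' Ex Ex'|c' k]; first by rewrite !mul0r scaler0.
  by rewrite !mulrDl scalerDr Ex Ex'.
by rewrite /GRing.mul /= /qtorus_mul !lextU lextZ !scalerA mulrC.
Qed.

HB.instance Definition _ := GRing.Lalgebra_isAlgebra.Build F W qtorus_scaleAr.

Definition qt_l : W := << (1, 0) >>.
Definition qt_m : W := << (0, 1) >>.

Lemma qt_mulUU c1 c2 (k1 k2 : int * int) :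
  (<< c1 *g k1 >> : W) * << c2 *g k2 >> =
  << c1 * c2 * q ^ (- (2 * k1.2 * k2.1)) *g (k1 + k2)%R >>.
Proof. exact: qtorus_mulUU. Qed.

Lemma qt_ZU c d (k : int * int) : c *: (<< d *g k >> : W) = << c * d *g k >>.
Proof. exact: malgZU. Qed.

Lemma qt_lm : qt_l * qt_m = q ^+ 2 *: (qt_m * qt_l).
Proof.
by rewrite !qt_mulUU qt_ZU /= -[q ^+ 2]/(q ^ 2%:Z) !mul1r -expfzDr.
Qed.

(* e_(r,s) = q^(-rs) l^r m^s *)
Definition qt_e (p : int * int) : W := << q ^ (- (p.1 * p.2)) *g p >>.

Lemma qt_eM (p t : int * int) :
  qt_e p * qt_e t = q ^ (p.1 * t.2 - p.2 * t.1) *: qt_e (p + t).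
Proof.
rewrite qt_mulUU -!expfzDr // qt_ZU -expfzDr //; congr (<< q ^ _ *g _ >>) => /=.
by ring.
Qed.

(* Left multiplication of the column vector p by B. *)
Definition SL2_vec (B : 'M[int]_2) (p : int * int) : int * int :=
  (B 0 0 * p.1 + B 0 1 * p.2, B 1 0 * p.1 + B 1 1 * p.2).

(* By linearity from e_p |-> e_(B p): the monomial l^r m^s is q^(rs) e_(r,s). *)
Definition qt_act (B : 'M[int]_2) : W -> W :=
  lext (fun p : int * int => q ^ (p.1 * p.2) *: qt_e (SL2_vec B p)).

Lemma qt_act_e B p : qt_act B (qt_e p) = qt_e (SL2_vec B p).
Proof. by rewrite /qt_act lextU scalerA -expfzDr // addNr expr0z scale1r. Qed.

Lemma qt_act_linear B : linear (qt_act B).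
Proof. exact: lext_linear. Qed.

Lemma qt_ind (P : W -> Prop) :
    P 0 -> (forall x y, P x -> P y -> P (x + y)) ->
    (forall c k, P << c *g k >>) ->
  forall x, P x.
Proof. exact: malg_ind. Qed.

Lemma qt_Ue c (k : int * int) :
  (<< c *g k >> : W) = (c * q ^ (k.1 * k.2)) *: qt_e k.
Proof.
rewrite /qt_e (qt_ZU _ _ k) -mulrA -(expfzDr _ _ q0) subrr.
by rewrite expr0z mulr1.
Qed.

Lemma SL2_vec_symplectic (B : 'M[int]_2) (p t : int * int) : \det B = 1 ->
  (SL2_vec B p).1 * (SL2_vec B t).2 - (SL2_vec B p).2 * (SL2_vec B t).1
    = p.1 * t.2 - p.2 * t.1.
Proof.
move=> detB.
have detE : B 0 0 * B 1 1 - B 0 1 * B 1 0 = 1 by rewrite -detB (expand_det_row _ 0) !big_ord_recl big_ord0 /cofactor !det_mx11 !mxE /= addr0 expr0 expr1 mul1r mulN1r mulrN; congr (_ * B _ _ - B _ _ * B _ _); apply/val_inj.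
by rewrite -[RHS]mul1r -[X in _ = X * _]detE /=; ring.
Qed.

Lemma SL2_vecD B p t : SL2_vec B (p + t) = SL2_vec B p + SL2_vec B t.
Proof. by apply: injective_projections => /=; ring. Qed.

Lemma qt_act_monoid_morphism B : \det B = 1 -> GRing.monoid_morphism (qt_act B).
Proof.
move=> detB.
have actD x y : qt_act B (x + y) = qt_act B x + qt_act B y by exact: lextD.
have actZ c x : qt_act B (c *: x) = c *: qt_act B x by exact: lextZ.
have act0 : qt_act B 0 = 0 by exact: raddf0.
split.
  have e0 : 1 = qt_e 0 by rewrite /qt_e mulr0 oppr0 expr0z.
  by rewrite e0 qt_act_e; congr qt_e; rewrite /SL2_vec !mulr0 addr0.
move=> x y; elim/qt_ind: x => [|x x' Ex Ex'|c k].
- by rewrite (mul0r y) act0 mul0r.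
- by rewrite (mulrDl x x') !actD Ex Ex' mulrDl.
elim/qt_ind: y => [|y y' Ey Ey'|c' k'].
- by rewrite (mulr0 (_ : W)) act0 mulr0.
- by rewrite (mulrDr (<< c *g k >> : W) y y') (actD (_ * _)) (actD y) Ey Ey' mulrDr.
have actE : qt_act B (qt_e k * qt_e k') = qt_act B (qt_e k) * qt_act B (qt_e k').
  rewrite (qt_eM k k') (actZ (q ^ _) (qt_e (k + k'))).
  rewrite (qt_act_e B (k + k')) (qt_act_e B k) (qt_act_e B k').
  by rewrite (qt_eM (SL2_vec B k)) SL2_vecD SL2_vec_symplectic.
rewrite (qt_Ue c k) (qt_Ue c' k').
exact: (alg_mul_scale actZ).
Qed.
End QuantumTorus.

Section MatrixIntPower.
Context (F : fieldType).

Definition mxpowz n (A : 'M[F]_n) (z : int) : 'M[F]_n :=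
  match z with Posz k => A ^+ k | Negz k => invmx (A ^+ k.+1) end.

Lemma mxpowzE n (A : 'M[F]_n.+1) z : mxpowz A z = A ^ z.
Proof. by case: z. Qed.

Lemma qcomm_exprz n (x y : 'M[F]_n.+1) c : c != 0 -> y \is a GRing.unit ->
  x * y = c *: (y * x) -> forall u : int, x * y ^ u = c ^ u *: (y ^ u * x).
Proof.
move=> c0 yU xy; have cU : c \is a GRing.unit by rewrite unitfE.
have xyV : x * y^-1 = c^-1 *: (y^-1 * x).
  have E : y^-1 * x = c *: (x * y^-1).
    by rewrite -[LHS](mulrK yU) -(mulrA _ x) xy -scalerAr -scalerAl mulKr.
  by rewrite E scalerA mulVf // scale1r.
elim/int_rect => [|k IH|k IH].
- by rewrite !expr0z mulr1 mul1r scale1r.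
- rewrite (intS k) (addrC 1) !exprzDr // !expr1z mulrA IH -scalerAl.
  by rewrite -(mulrA _ x y) xy -scalerAr scalerA mulrA.
rewrite (intS k) (addrC 1) opprD !exprzDr // !exprN1 mulrA IH -scalerAl.
by rewrite -(mulrA _ x) xyV -scalerAr scalerA mulrA.
Qed.

End MatrixIntPower.

Section ClockShift.
Context (F : fieldType) (q : F) (n : nat).

Lemma primitive_root_neq0 : n.-primitive_root q -> q != 0.
Proof.
move=> qn; apply/eqP => q0; have /eqP := prim_expr_order qn.
by rewrite q0 expr0n gtn_eqF ?(prim_order_gt0 qn) // eq_sym oner_eq0.
Qed.

Definition shift_mx : 'M[F]_n := \matrix_(i, j) (i == j.+1 %[mod n])%:R.

Definition clock_mx : 'M[F]_n := \matrix_(i, j) ((i == j)%:R * q ^- (2 * i)).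

Lemma shift_mx_unit : shift_mx \in unitmx.
Proof.
have -> : shift_mx = (perm_mx (perm (@ordS_inj n)))^T.
  apply/matrixP => i j; rewrite !mxE permE -val_eqE /= eq_sym.
  by rewrite (modn_small (ltn_ord i)).
by rewrite unitmx_tr unitmx_perm.
Qed.

Lemma clock_mx_unit : q != 0 -> clock_mx \in unitmx.
Proof.
move=> q0; have -> : clock_mx = diag_mx (\row_i q ^- (2 * i)).
  by apply/matrixP => i j; rewrite !mxE; case: eqP; rewrite ?mul1r ?mul0r.
rewrite unitmxE det_diag unitfE; apply/prodf_neq0 => i _.
by rewrite mxE invr_eq0 expf_neq0.
Qed.

Lemma shift_clock : n.-primitive_root q ->
  shift_mx *m clock_mx = q ^+ 2 *: (clock_mx *m shift_mx).
Proof.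
move=> qn; apply/matrixP => i j; rewrite !mxE.
rewrite (bigD1 j) //= big1 ?addr0; last first.
  by move=> k kj; rewrite !mxE (negPf kj) mul0r mulr0.
rewrite (bigD1 i) //= big1 ?addr0; last first.
  by move=> k ki; rewrite !mxE eq_sym (negPf ki) !mul0r.
rewrite !mxE !eqxx !mul1r; case: eqP => [ij|_]; last by rewrite mul0r !mulr0.
have q0 : q != 0 := primitive_root_neq0 qn.
have -> : q ^+ (2 * i) = q ^+ (2 * j.+1).
  by rewrite ![(2 * _)%N]mulnC !exprM -(prim_expr_mod qn i) ij prim_expr_mod.
by rewrite mul1r mulr1 mulnS exprD invfM mulrA divff ?mul1r ?expf_neq0.
Qed.

End ClockShift.

Section Representation.
Context (F : fieldType) (q : F) (q0 : q != 0) (n : nat).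
Local Notation W := (qtorus q0).
Local Notation L := (shift_mx F n).
Local Notation M := (clock_mx q n).

(* l^r m^s |-> L^r M^s; an algebra morphism as soon as q is a primitive n-th
   root of unity. *)
Definition qt_rho : W -> 'M[F]_n :=
  lext (fun p : int * int => mxpowz L p.1 *m mxpowz M p.2).

Lemma qt_rho_linear : linear qt_rho.
Proof. exact: lext_linear. Qed.

Lemma qt_rho_l : qt_rho (qt_l q0) = L.
Proof. by rewrite /qt_rho lextU scale1r /= expr0 mulmx1 expr1. Qed.

Lemma qt_rho_m : qt_rho (qt_m q0) = M.
Proof. by rewrite /qt_rho lextU scale1r /= expr0 mul1mx expr1. Qed.

Lemma qt_rho_monoid_morphism :
  n.-primitive_root q -> GRing.monoid_morphism qt_rho.
Proof.
move=> qn.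
have rhoD x y : qt_rho (x + y) = qt_rho x + qt_rho y by exact: lextD.
have rho0 : qt_rho 0 = 0 by exact: raddf0.
have rhoU c k : qt_rho << c *g k >> = c *: (mxpowz L k.1 *m mxpowz M k.2).
  by rewrite /qt_rho lextU.
split.
  by rewrite -[1]/(<< 1 *g (0, 0) >> : W) rhoU scale1r /= !expr0 mulmx1.
move=> x y; elim/qt_ind: x => [|x x' Ex Ex'|c k].
- by rewrite (mul0r y) rho0 mul0r.
- by rewrite (mulrDl x x') !rhoD Ex Ex' mulrDl.
elim/qt_ind: y => [|y y' Ey Ey'|c' k'].
- by rewrite (mulr0 (_ : W)) rho0 mulr0.
- by rewrite (mulrDr (<< c *g k >> : W) y y') (rhoD (_ * _)) (rhoD y) Ey Ey' mulrDr.
rewrite qt_mulUU !rhoU /=; move: k.1 k.2 k'.1 k'.2 => r s u v {rhoD rho0 rhoU}.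
have := shift_clock qn; have := clock_mx_unit n q0; have := shift_mx_unit F n.
have : (0 < n)%N := prim_order_gt0 qn.
move: (L) (M); case: n => // n' A B _ AU BU AB; rewrite !mxpowzE.
have q20 : q ^+ 2 != 0 by rewrite expf_neq0.
have BA : B * A = q ^ (-2) *: (A * B).
  by rewrite -[A * B]/(A *m B) AB scalerA mulVf // scale1r.
have BAu := qcomm_exprz (expfz_neq0 (-2) q0) AU BA u.
have ABu : A ^ u * B = q ^ (2 * u) *: (B * A ^ u).
  by rewrite BAu scalerA exprz_exp -expfzDr // -mulrDl subrr mul0r scale1r.
have ABsu := qcomm_exprz (expfz_neq0 (2 * u) q0) BU ABu s.
have BsAu : B ^ s * A ^ u = q ^ (- (2 * s * u)) *: (A ^ u * B ^ s).
  rewrite ABsu scalerA exprz_exp -expfzDr //.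
  by rewrite (_ : _ + _ = 0) ?scale1r //; ring.
rewrite -[RHS]/((c *: (A ^ r * B ^ s)) * (c' *: (A ^ u * B ^ v))).
rewrite -[_ *m _]/(A ^ (r + u) * B ^ (s + v)) !exprzDr //.
rewrite -scalerAl -scalerAr scalerA !mulrA -(mulrA _ _ (A ^ u)) BsAu.
by rewrite -scalerAr -!scalerAl scalerA !mulrA.
Qed.

End Representation.

Section ConjugatingMatrix.
Context (F : fieldType) (q : F) (q0 : q != 0) (n : nat).

(* theta is the algebra automorphism of 'M_n induced by the action of B; it is
   unique as soon as qt_rho is surjective. *)
Definition induced_aut (B : 'M[int]_2) (theta : 'M[F]_n -> 'M[F]_n) : Prop :=
  [/\ bijective theta, linear theta, GRing.monoid_morphism theta &
      forall x : qtorus q0,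
        theta (qt_rho n x) = qt_rho n (qt_act B x)].

Definition conjugating_mx (B : 'M[int]_2) (C : 'M[F]_n) : Prop :=
  C \in unitmx /\
  exists theta, induced_aut B theta /\
    forall X : 'M[F]_n, theta X = C *m X *m invmx C.

End ConjugatingMatrix.

(* Main.v *)
(* Write chi x = q^x for x in Z/n.  In coordinates L^r M^s is the weighted
   shift (x, y) |-> [x = y + r] chi(-2 s y), so conjugating by D induces the
   action of B iff the entries D x (y + r) and D (x - a r - b s) y have a
   prescribed ratio for all r, s.  The stated exponent e satisfies these
   relations, and since b <> 0 they determine D from its entry at (0, 0).
   Invertibility of chi(e x y) is orthogonality of characters: two columns y, z
   differ by the character x |-> chi(2 b^-1 (z - y) x), up to a constant. *)
Require Import Defs.
From mathcomp Require Import all_boot all_order all_algebra.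
From mathcomp Require Import reals complex.
From mathcomp Require Import ring.

Set Implicit Arguments.
Unset Strict Implicit.
Unset Printing Implicit Defensive.

Import GRing.Theory Num.Theory.
Local Open Scope ring_scope.

(** * Matrices with rows and columns indexed by Z/n *)

Section PrimeIndexedMatrices.
Context (F : fieldType) (n : nat) (n_prime : prime n).

(** The bound of the ordinal type ['F_n] equals [n] only propositionally, through primality, hence
    the cast. *)
Definition Fp_ord (x : 'F_n) : 'I_n := cast_ord (Fp_cast n_prime) x.

Lemma Fp_ordK (x : 'F_n) : (Fp_ord x)%:R = x.
Proof. exact: natr_Zp. Qed.

Lemma ord_natrK (i : 'I_n) : Fp_ord i%:R = i.
Proof. by apply: val_inj; rewrite /= val_Fp_nat ?modn_small. Qed.

Definition Fp_mx (f : 'F_n -> 'F_n -> F) : 'M[F]_n :=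
  \matrix_(i, j) f i%:R j%:R.

Lemma eq_Fp_mx f g : Fp_mx f = Fp_mx g <-> f =2 g.
Proof.
split=> [/matrixP fg x y|fg]; last by apply/matrixP => i j; rewrite !mxE fg.
by have := fg (Fp_ord x) (Fp_ord y); rewrite !mxE !Fp_ordK.
Qed.

Lemma mx_Fp_mx (A : 'M[F]_n) : A = Fp_mx (fun x y => A (Fp_ord x) (Fp_ord y)).
Proof. by apply/matrixP => i j; rewrite mxE !ord_natrK. Qed.

Lemma mul_Fp_mx f g :
  Fp_mx f *m Fp_mx g = Fp_mx (fun x z => \sum_y f x y * g y z).
Proof.
apply/matrixP => i k; rewrite !mxE (reindex Fp_ord) /=; last first.
  by exists (fun i : 'I_n => i%:R) => x _; rewrite (Fp_ordK, ord_natrK).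
by apply: eq_bigr => y _; rewrite !mxE Fp_ordK.
Qed.

Lemma scalar_Fp_mx a : a%:M = Fp_mx (fun x y => a *+ (x == y)).
Proof.
apply/matrixP => i j; rewrite !mxE; congr (_ *+ _).
by rewrite (inj_eq (can_inj ord_natrK)).
Qed.

Lemma scale_Fp_mx a f : a *: Fp_mx f = Fp_mx (fun x y => a * f x y).
Proof. by apply/matrixP => i j; rewrite !mxE. Qed.

End PrimeIndexedMatrices.

(** Since [P k *m P (- k) = 1], negative powers also follow the family [P]. This gives closed forms
    for all integer powers of the shift and clock matrices. *)
Lemma mxpowz_morph (F : fieldType) n (P : int -> 'M[F]_n) :
    P 0 = 1%:M -> (forall y z, P (y + z) = P y *m P z) ->
  forall z, mxpowz (P 1) z = P z.
Proof.
move=> P0 PD.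
have Pn (k : nat) : P 1 ^+ k = P k.
  by elim: k => [|k IH]; rewrite ?expr0 ?P0 // exprS IH intS PD.
case=> k; rewrite /mxpowz Pn // NegzE.
have PP : P k.+1 *m P (- k.+1%:Z) = 1%:M by rewrite -PD subrr.
by rewrite -[RHS](mulKmx (mulmx1_unit PP).1) PP mulmx1.
Qed.

(** * Additive characters of Z/n and the clock and shift matrices *)

Section PrimitiveRootCharacter.
Context (F : fieldType) (n : nat) (q : F).
Context (n_prime : prime n) (q_prim : n.-primitive_root q).

Definition Fp_chi (x : 'F_n) : F := q ^+ x.
Local Notation chi := Fp_chi.

Let q0 : q != 0 := primitive_root_neq0 q_prim.

Lemma Fp_chi_nat (k : nat) : chi k%:R = q ^+ k.
Proof. by rewrite /chi val_Fp_nat // prim_expr_mod. Qed.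

Lemma Fp_chiD : {morph chi : x y / x + y >-> x * y}.
Proof.
move=> x y; rewrite -[x in LHS]natr_Zp -[y in LHS]natr_Zp -natrD.
by rewrite Fp_chi_nat exprD.
Qed.

Lemma Fp_chi_neq0 x : chi x != 0.
Proof. exact: expf_neq0. Qed.

Lemma Fp_chi0 : chi 0 = 1.
Proof. exact: expr0. Qed.

Lemma Fp_chiN x : chi (- x) = (chi x)^-1.
Proof.
apply: (mulIf (Fp_chi_neq0 x)).
by rewrite -Fp_chiD addNr Fp_chi0 mulVf ?Fp_chi_neq0.
Qed.

Lemma Fp_chi_int (z : int) : chi z%:~R = q ^ z.
Proof. by case: z => k; rewrite ?NegzE ?mulrNz ?Fp_chiN Fp_chi_nat. Qed.

Lemma Fp_chi_eq1 x : (chi x == 1) = (x == 0).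
Proof.
by rewrite -(prim_order_dvd q_prim) -{2}[x]natr_Zp
  -(dvdn_pcharf (pchar_Fp n_prime)).
Qed.

(** Translating [x] by 1 multiplies the sum by [chi t], which differs from 1 when [t != 0] because
    [q] is primitive. *)
Lemma sum_Fp_chi t : \sum_x chi (t * x) = n%:R *+ (t == 0).
Proof.
case: eqP => [->|/eqP t0].
  under eq_bigr => x _ do rewrite mul0r Fp_chi0.
  by rewrite sumr_const card_Fp.
have chit : chi t - 1 != 0 by rewrite subr_eq0 Fp_chi_eq1.
apply: (mulfI chit); rewrite mulr0 mulrBl mul1r mulr_sumr.
apply/eqP; rewrite subr_eq0 eq_sym (reindex_inj (addrI 1)) /=.
by apply/eqP/eq_bigr => x _; rewrite mulrDr mulr1 Fp_chiD.
Qed.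

Lemma shift_Fp_mx : shift_mx F n = Fp_mx (fun x y => (x == y + 1)%:R).
Proof.
apply/matrixP => i j; rewrite !mxE; congr (_%:R).
by rewrite natr1 -val_eqE /= !val_Fp_nat.
Qed.

Lemma clock_Fp_mx :
  clock_mx q n = Fp_mx (fun x y => (x == y)%:R * chi (- (2 * y))).
Proof.
apply/matrixP => i j; rewrite !mxE (inj_eq (can_inj (ord_natrK n_prime))).
case: eqP => [->|_]; last by rewrite !mul0r.
by rewrite -natrM Fp_chiN Fp_chi_nat.
Qed.

Lemma mxpowz_shift z :
  mxpowz (shift_mx F n) z = Fp_mx (fun x y => (x == y + z%:~R)%:R).
Proof.
pose P z : 'M[F]_n := Fp_mx (fun x y => (x == y + z%:~R)%:R).
rewrite shift_Fp_mx (@mxpowz_morph _ _ P) // => [|y z'].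
  by rewrite scalar_Fp_mx //; apply/eq_Fp_mx => // x y; rewrite addr0.
rewrite mul_Fp_mx //; apply/eq_Fp_mx => // x t.
rewrite (bigD1 (t + z'%:~R)) //= eqxx mulr1 big1 ?addr0 => [|u /negPf->].
  by rewrite intrD [y%:~R + _]addrC addrA.
by rewrite mulr0.
Qed.

Lemma mxpowz_clock z :
  mxpowz (clock_mx q n) z =
  Fp_mx (fun x y => (x == y)%:R * chi (- (2 * z%:~R * y))).
Proof.
pose P z : 'M[F]_n := Fp_mx (fun x y => (x == y)%:R * chi (- (2 * z%:~R * y))).
have -> : clock_mx q n = P 1.
  by rewrite clock_Fp_mx; apply/eq_Fp_mx => // x y; rewrite mulr1.
rewrite (@mxpowz_morph _ _ P) // => [|y z'].
  rewrite scalar_Fp_mx //; apply/eq_Fp_mx => // x y.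
  by rewrite mulr0 mul0r oppr0 Fp_chi0 mulr1.
rewrite mul_Fp_mx //; apply/eq_Fp_mx => // x t.
rewrite (bigD1 t) //= big1 ?addr0 => [|u /negPf->]; last by rewrite mul0r mulr0.
rewrite eqxx mul1r -[RHS]mulrA -Fp_chiD intrD; congr (_ * chi _); ring.
Qed.

Lemma qt_rho_e (qn0 : q != 0) p :
  qt_rho n (qt_e qn0 p) =
  Fp_mx (fun x y => (x == y + p.1%:~R)%:R *
                    chi (- (p.1%:~R * p.2%:~R) - 2 * p.2%:~R * y)).
Proof.
rewrite /qt_rho lextU mxpowz_shift mxpowz_clock mul_Fp_mx // scale_Fp_mx //.
apply/eq_Fp_mx => // x y.
rewrite (bigD1 y) //= big1 ?addr0 => [|u /negPf->]; last by rewrite mul0r mulr0.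
by rewrite eqxx mul1r mulrCA -Fp_chi_int -Fp_chiD intrN intrM.
Qed.

Lemma mul_mx_qt_rho_e (qn0 : q != 0) f p :
  Fp_mx f *m qt_rho n (qt_e qn0 p) =
  Fp_mx (fun x y => chi (- (p.1%:~R * p.2%:~R) - 2 * p.2%:~R * y) *
                    f x (y + p.1%:~R)).
Proof.
rewrite qt_rho_e mul_Fp_mx //; apply/eq_Fp_mx => // x y.
rewrite (bigD1 (y + p.1%:~R)) //= eqxx mul1r big1 ?addr0 => [|u /negPf->].
  by rewrite mulrC.
by rewrite mul0r mulr0.
Qed.

Lemma mul_qt_rho_e_mx (qn0 : q != 0) f p :
  qt_rho n (qt_e qn0 p) *m Fp_mx f =
  Fp_mx (fun x y => chi (p.1%:~R * p.2%:~R - 2 * p.2%:~R * x) *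
                    f (x - p.1%:~R) y).
Proof.
rewrite qt_rho_e mul_Fp_mx //; apply/eq_Fp_mx => // x y.
rewrite (bigD1 (x - p.1%:~R)) //= subrK eqxx mul1r big1 ?addr0 => [|u].
  (* With p = (r, s), the surviving index is x - r, where the phase -rs - 2s(x - r) becomes rs -
     2sx. *)
  by congr (chi _ * _); ring.
by rewrite eq_sym -subr_eq eq_sym => /negPf->; rewrite !mul0r.
Qed.

End PrimitiveRootCharacter.

(** * Intertwining relations and their solutions *)

Section Intertwiner.
Context (F : fieldType) (n : nat) (q : F) (q0 : q != 0) (B : 'M[int]_2).
Context (n_prime : prime n) (q_prim : n.-primitive_root q).
Local Notation chi := (@Fp_chi F n q).
Local Notation rho := (@qt_rho F q q0 n).

Lemma qt_eq_linear (V : lmodType F) (f g : qtorus q0 -> V) :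
    linear f -> linear g -> (forall p, f (qt_e q0 p) = g (qt_e q0 p)) ->
  f =1 g.
Proof.
move=> fL gL fg x.
have L0 (h : qtorus q0 -> V) : linear h -> h 0 = 0.
  (* Linearity at scalar -1 and zero vectors reads h 0 = - h 0 + h 0. *)
  by move=> /(_ (-1) 0 0); rewrite !scaleN1r !addNr.
elim/qt_ind: x => [|x y Ex Ey|a k]; first by rewrite !L0.
  by rewrite -[x]scale1r fL gL Ex Ey.
by rewrite qt_Ue -[_ *: _]addr0 fL gL fg !L0.
Qed.

(** This eliminates [theta]: conjugation by an invertible matrix is already an algebra automorphism,
    and compatibility with [B] is linear, so it suffices to test it on the basis. *)
Lemma conjugating_mx_intertwines (D : 'M[F]_n) :
  conjugating_mx q0 B D <->
  D \in unitmx /\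
  forall p, D *m rho (qt_e q0 p) = rho (qt_e q0 (SL2_vec B p)) *m D.
Proof.
split=> [[DU [theta [[_ _ _ thetaE] conjE]]]|[DU Dp]]; split=> //.
  by move=> p; rewrite -qt_act_e -thetaE conjE mulmxKV.
exists (fun X => D *m X *m invmx D); split=> //; split.
- exists (fun X => invmx D *m X *m D) => X.
    by rewrite !mulmxA mulVmx // mul1mx mulmxKV.
  by rewrite !mulmxA mulmxV // mul1mx mulmxK.
- by move=> k X Y; rewrite mulmxDr mulmxDl -scalemxAr -scalemxAl.
- split=> [|X Y]; first by rewrite mulmx1 mulmxV.
  by rewrite -!mulmxE !mulmxA mulmxKV.
have rhoL := @qt_rho_linear F q q0 n.
apply: qt_eq_linear => [k x y|k x y|p].
- by rewrite rhoL mulmxDr mulmxDl -scalemxAr -scalemxAl.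
- by rewrite qt_act_linear rhoL.
by rewrite Dp mulmxK // qt_act_e.
Qed.

Local Notation a := ((B 0 0)%:~R : 'F_n).
Local Notation b := ((B 0 1)%:~R : 'F_n).
Local Notation c := ((B 1 0)%:~R : 'F_n).
Local Notation d := ((B 1 1)%:~R : 'F_n).

Context (detB : \det B = 1) (b0 : b != 0) (n_odd : odd n).

Definition conj_exponent (i j : 'F_n) : 'F_n :=
  - b^-1 * d * (i - a * j) ^+ 2 - 2 * c * j * (i - a * j) - a * c * j ^+ 2.
Local Notation e := conj_exponent.

Lemma det_mod : a * d - b * c = 1.
Proof.
rewrite -!intrM -intrB -[RHS]/(1%:~R); congr (_%:~R).
(* The symplectic pairing of the two columns of [B] is its determinant. *)
have := SL2_vec_symplectic (1, 0) (0, 1) detB.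
by rewrite /= !mulr1 !mulr0 !addr0 !add0r [B 1 0 * _]mulrC.
Qed.

(** Eliminating [c] turns the exponent identities below into rational identities in free variables
    whose only denominator is [b]. *)
Lemma bottom_left_mod : c = (a * d - 1) / b.
Proof. by rewrite -[X in _ - X]det_mod subKr mulrC mulKf. Qed.

(** This is the exponent form of the entry (x, y) of the intertwining relation for e_(r,s). *)
Lemma conj_exponent_shift (r s x y : 'F_n) :
  - (r * s) - 2 * s * y + e x (y + r) =
  (a * r + b * s) * (c * r + d * s) - 2 * (c * r + d * s) * x
    + e (x - (a * r + b * s)) y.
Proof.
by rewrite /e bottom_left_mod; field.
Qed.

(** The x^2 coefficient of [e x y] is independent of y, and its xy coefficient is 2(ad - bc)/b =
    2/b; hence the difference is affine in x. *)
Lemma conj_exponent_diff (x y z : 'F_n) :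
  e x z - e x y = 2 * b^-1 * (z - y) * x + (e 0 z - e 0 y).
Proof.
by rewrite /e bottom_left_mod; field.
Qed.

(** Oddness of [n] enters here; it keeps the slope 2 b^-1 (z - y) nonzero for distinct columns. *)
Lemma two_neq0 : (2 : 'F_n) != 0.
Proof.
rewrite -(dvdn_pcharf (pchar_Fp n_prime)) dvdn_prime2 //.
by apply: contraTneq n_odd => ->.
Qed.

Definition conj_mx : 'M[F]_n := Fp_mx (fun x y => chi (e x y)).

Lemma conj_mx_unit : conj_mx \in unitmx.
Proof.
have n0 : (n%:R : F) != 0 .
  exact: prim_root_natf_neq0 q_prim.
(* The candidate inverse is 1/n times the transpose of the entrywise inverse. *)
suff /mulmx1_unit[] :
    (n%:R^-1 *: Fp_mx (fun y x => chi (- e x y))) *m conj_mx = 1%:M by [].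
rewrite -scalemxAl mul_Fp_mx // scale_Fp_mx // scalar_Fp_mx //.
apply/eq_Fp_mx => // y z.
transitivity (n%:R^-1 *
    \sum_x chi (2 * b^-1 * (z - y) * x) * chi (e 0 z - e 0 y)).
  congr (_ * _); apply: eq_bigr => x _.
  by rewrite -!Fp_chiD // addrC (conj_exponent_diff x).
rewrite -mulr_suml sum_Fp_chi // !mulf_eq0 invr_eq0.
rewrite (negPf b0) (negPf two_neq0) /=.
rewrite subr_eq0 eq_sym; case: eqP => [->|_]; last by rewrite mul0r mulr0.
by rewrite subrr Fp_chi0 mulr1 mulVf.
Qed.

Lemma conj_mx_intertwines p :
  conj_mx *m rho (qt_e q0 p) = rho (qt_e q0 (SL2_vec B p)) *m conj_mx.
Proof.
rewrite mul_mx_qt_rho_e // mul_qt_rho_e_mx //; apply/eq_Fp_mx => // x y.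
by rewrite -!Fp_chiD // conj_exponent_shift /= !(intrD, intrM).
Qed.

(* The intertwining relations determine the ratio of D to [conj_mx] along
   (i, j + r) -> (i - a r - b s, j); as b is invertible mod n, such a move
   joins any (i, j) to (0, 0). *)
Lemma intertwiner_unique (D : 'M[F]_n) :
    (forall p, D *m rho (qt_e q0 p) = rho (qt_e q0 (SL2_vec B p)) *m D) ->
  exists k, D = k *: conj_mx.
Proof.
rewrite (mx_Fp_mx n_prime D); set f := fun x y => _ => Df.
exists (f 0 0 / chi (e 0 0)); rewrite scale_Fp_mx //; apply/eq_Fp_mx => // x y.
(* With r = y and this s, the relation at entry (x, 0) links the entries of D at (x, y) and (0,
   0). *)
have [s sE] : exists s, a * y + b * s = x.
  by exists ((x - a * y) / b); rewrite mulrCA divff // mulr1 addrC subrK.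
have := Df ((y : nat)%:Z, (s : nat)%:Z).
have /= := conj_mx_intertwines ((y : nat)%:Z, (s : nat)%:Z).
rewrite !mul_mx_qt_rho_e // !mul_qt_rho_e_mx //=.
move=> /(eq_Fp_mx n_prime)/(_ x 0) + /(eq_Fp_mx n_prime)/(_ x 0).
rewrite !(intrD, intrM) -!pmulrn !natr_Zp add0r sE subrr => Ce De.
(* [D] and [conj_mx] satisfy the same relation with the same phases, so their ratio at (x, y) is the
   one at (0, 0). *)
apply: (mulfI (Fp_chi_neq0 q_prim (- (y * s) - 2 * s * 0))).
rewrite De mulrCA Ce mulrCA.
by rewrite divfK ?Fp_chi_neq0.
Qed.

End Intertwiner.

Theorem theorem9 (R : realType) (n : nat) (q : R[i]) (q0 : q != 0)
    (B : 'M[int]_2) :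
  prime n -> odd n -> n.-primitive_root q -> \det B = 1 ->
  let a : 'F_n := (B 0 0)%:~R in
  let b : 'F_n := (B 0 1)%:~R in
  let c : 'F_n := (B 1 0)%:~R in
  let d : 'F_n := (B 1 1)%:~R in
  b != 0 ->
  let e (i j : 'F_n) : 'F_n :=
    - b^-1 * d * (i - a * j) ^+ 2 - 2 * c * j * (i - a * j) - a * c * j ^+ 2 in
  let C : 'M[R[i]]_n := \matrix_(i, j) q ^+ e i%:R j%:R in
  forall D : 'M[R[i]]_n,
    conjugating_mx q0 B D <-> exists2 k : R[i], k != 0 & D = k *: C.
Proof.
move=> n_prime n_odd q_prim detB a b c d b0 e C D.
have CE : C = conj_mx n q B by [].
rewrite CE conjugating_mx_intertwines; split=> [[DU Dp]|[k k0 ->]].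
  have [k Dk] := intertwiner_unique n_prime q_prim detB b0 Dp; exists k => //.
  (* If k = 0, the scalar factor has determinant 0^n, which is 0 because n > 0. *)
  apply: contraTneq DU => k0; rewrite Dk k0 -mul_scalar_mx unitmx_mul.
  by rewrite unitmxE det_scalar expr0n gtn_eqF ?prime_gt0 // unitr0.
split=> [|p]; first by rewrite unitmxZ ?unitfE ?conj_mx_unit.
by rewrite -scalemxAl -scalemxAr conj_mx_intertwines.
Qed.
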